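(* Let $\mathcal{S}=\overline{\mathbb{Z}}_{\max}[\![\gamma]\!]$, and let $A\in\mathcal{S}^{n\times n}$, $B\in\mathcal{S}^{n\times p}$, $C$, $R\in\mathcal{S}^{n\times l}$ be the matrices of a timed event graph satisfying the standing assumptions in the context. Let $k$ be the number of strongly connected components of the timed event graph. Assume that $C\in\mathcal{S}^{k\times n}$ and that each strongly connected component is linked to one and only one output, i.e. for each strongly connected component $K\subseteq\{1,\dots,n\}$ there is exactly one row $j$ of $C$ whose entry $e$ lies in a column belonging to $K$. For $u\in\mathcal{S}^p$, $w\in\mathcal{S}^l$ let $x=A^\ast Bu\oplus A^\ast Rw$ be the state, i.e. the least solution of $x=Ax\oplus Bu\oplus Rw$, let $y=Cx$, and let $\hat{x}$ be the estimated state obtained with the observer matrix $$L_x=\big((A^\ast B)/(CA^\ast B)\big)\wedge\big((A^\ast R)/(CA^\ast R)\big),$$ i.e. the least solution of $\hat{x}=A\hat{x}\oplus Bu\oplus L_x(C\hat{x}\oplus y)$. Then $$\sigma_\infty(x_i)=\sigma_\infty(\hat{x}_i)\qquad\text{for all } i\in\{1,\dots,n\},$$ for all $u,w$ for which these asymptotic slopes are defined (i.e. $x_i$ and $\hat{x}_i$ are periodic series).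
   Context: Idempotent semiring. $\overline{\mathbb{Z}}_{\max}=\mathbb{Z}\cup\{-\infty,+\infty\}$ with $\oplus=\max$ and $\otimes=+$ (and $(-\infty)+(+\infty)=-\infty$). $\mathcal{S}=\overline{\mathbb{Z}}_{\max}[\![\gamma]\!]$ is the set of formal series $s=\bigoplus_{k\in\mathbb{Z}}s(k)\gamma^k$, $s(k)\in\overline{\mathbb{Z}}_{\max}$, with coefficientwise sum and Cauchy product, subject to the rule $t\gamma^{n_1}\oplus t\gamma^{n_2}=t\gamma^{\min(n_1,n_2)}$ (i.e. a series is identified with the series with nondecreasing coefficients $k\mapsto\sup_{j\le k}s(j)$). It is a complete idempotent semiring (closed under infinite $\oplus$-sums, over which $\otimes$ distributes) with zero $\varepsilon$ (absorbing) and unit $e=0\gamma^0$. Order: $a\succeq b\iff a=a\oplus b$; $\wedge$ is the greatest lower bound. $\otimes$ is often omitted. Matrices. Sum, product, order and $\wedge$ of matrices are the usual ones built from the scalar ones (sum, order and $\wedge$ are entrywise); $e$ also denotes the identity matrix. For a square matrix $M$, $M^\ast=\bigoplus_{i\in\mathbb{N}}M^i$ with $M^0=e$; the least solution of $x=Mx\oplus b$ is $M^\ast b$. For matrices $P\in\mathcal{S}^{n\times q}$ and $Q\in\mathcal{S}^{m\times q}$, $P/Q\in\mathcal{S}^{n\times m}$ denotes the greatest matrix $X$ with $XQ\preceq P$ (right residuation). Standing assumptions on the system. Each column of $B$ (resp. $R$) has exactly one entry equal to $e$, the others being $\varepsilon$, and each row has at most one entry equal to $e$. Each row of $C$ has exactly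 one entry equal to $e$, the others being $\varepsilon$, and each column has at most one entry equal to $e$. Strongly connected components. The internal transitions of the timed event graph are indexed by $1,\dots,n$, with an arc from $j$ to $i$ when $A_{ij}\neq\varepsilon$; the strongly connected components are those of this directed graph (a single vertex without arc also counts as a component). The entries of $A^\ast$ are periodic series. Periodic series and asymptotic slope. A periodic series is a series $s=p\oplus q\,r^\ast$ where $p,q$ are polynomials (finite, possibly empty, sums of monomials $t\gamma^n$, $t,n\in\mathbb{Z}$) and $r=\tau\gamma^\nu$ is a monomial with $\tau,\nu\in\mathbb{N}$. Its asymptotic slope is $\sigma_\infty(s)=\nu/\tau$, with the convention that $\sigma_\infty(s)=+\infty$ when $s$ is a polynomial (in particular when $s=\varepsilon$). *)

(* Defs.v *)
From HB Require Import structures.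
From mathcomp Require Import all_boot all_order all_algebra.
From mathcomp Require Import boolp classical_sets constructive_ereal.
From mathcomp Require Import zify.

Set Implicit Arguments.
Unset Strict Implicit.
Unset Printing Implicit Defensive.

Import Order.TTheory GRing.Theory Num.Theory.

Local Open Scope classical_set_scope.
Local Open Scope ring_scope.

(** The coefficients live in [\bar int].  Its order is the usual one and its
    addition [+%E] satisfies [-oo + +oo = -oo], so [Order.max] and [+%E] are the
    sum and product of the (max,+) semiring. *)

Definition zsup (A : set (\bar int)) : \bar int := supremum -oo%E A.

Lemma zsup_supremums (A : set (\bar int)) :
  A !=set0 -> supremums A !=set0.
Proof.
move=> A0; have [[M MA]|nM] := pselect (exists M : int, ubound A M%:E); last first.
  exists +oo%E; split; first by move=> x _; rewrite leey.
  move=> y yA; case: y yA => [r| |] yA //; first by case: nM; exists r.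
  by exfalso; apply: nM; exists 0; move=> x /yA; rewrite leeNy_eq => /eqP ->.
have [[a Aa]|na] := pselect (exists a : int, A a%:E); last first.
  exists -oo%E; split; last by move=> y _; rewrite leNye.
  move=> [r| |] // Ar; first by case: na; exists r.
  by have := MA _ Ar.
have ex : exists n, `[< A (M - n%:Z)%:E >].
  exists `|M - a|%N; apply/asboolP.
  have : a <= M by have := MA _ Aa; rewrite lee_fin.
  by move=> aM; have -> : M - `|M - a|%N%:Z = a by lia.
case: (ex_minnP ex) => n /asboolP An nmin.
exists (M - n%:Z)%:E; split; last by move=> y; apply.
move=> [r| |] Ar; last by rewrite leNye.
  have rM : r <= M by have := MA _ Ar; rewrite lee_fin.
  have /nmin : `[< A (M - `|M - r|%N%:Z)%:E >].
    by apply/asboolP; have -> : M - `|M - r|%N%:Z = r by lia.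
  by rewrite lee_fin; lia.
by have := MA _ Ar.
Qed.

Lemma zsup_ub (A : set (\bar int)) x : A x -> (x <= zsup A)%E.
Proof.
by move=> Ax; apply: ge_supremum_Nmem => //; apply: zsup_supremums; exists x.
Qed.

Lemma zsup_leP (A : set (\bar int)) y :
  (zsup A <= y)%E <-> (forall x, A x -> x <= y)%E.
Proof.
split=> [Ay x Ax|Ay]; first exact: le_trans (zsup_ub Ax) Ay.
rewrite /zsup /supremum; case: ifPn => [_|/set0P A0]; first by rewrite leNye.
case: xgetP => [z _ [_ zA]|nA]; first exact: zA.
by have [z /nA] := zsup_supremums A0.
Qed.

Lemma zsup_addP (A : set (\bar int)) x y :
  (zsup A + x <= y)%E <-> (forall a, A a -> a + x <= y)%E.
Proof.
split=> [Ay a Aa|Ay]; first by apply: le_trans Ay; rewrite leeD2r ?zsup_ub.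
case: x y Ay => [x| |] y Ay; last by rewrite addeNy leNye.
- case: y Ay => [y| |] Ay; rewrite ?leey //.
    have /zsup_leP : forall a, A a -> (a <= (y - x)%:E)%E.
      by move=> [a| |] /Ay //; rewrite ?leNye // -EFinD !lee_fin; lia.
    by case: (zsup A) => [z| |] //; rewrite -?EFinD ?addNye ?leNye // !lee_fin; lia.
  have /zsup_leP : forall a, A a -> (a <= -oo)%E by move=> [a| |] /Ay.
  by rewrite leeNy_eq => /eqP ->.
- have [->|yoo] := eqVneq y +oo%E; first by rewrite leey.
  have /zsup_leP : forall a, A a -> (a <= -oo)%E.
    by move=> [a| |] /Ay //; case: y yoo {Ay}.
  by rewrite leeNy_eq => /eqP ->; rewrite addNye leNye.
Qed.

Lemma le_eqP d (T : porderType d) (x y : T) :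
  (forall z, (x <= z)%O <-> (y <= z)%O) -> x = y.
Proof. by move=> H; apply: le_anti; rewrite (H y).2 // (H x).1. Qed.

(** A series is represented by the unique member of its class (for
    [t g^n1 + t g^n2 = t g^(min n1 n2)]) whose coefficients are nondecreasing. *)

Record series := Series {
  coef :> int -> \bar int ;
  coef_homo : {homo coef : j k / j <= k >-> (j <= k)%E} }.

HB.instance Definition _ := gen_eqMixin series.
HB.instance Definition _ := gen_choiceMixin series.

Lemma seriesP (s t : series) : (forall k, s k = t k) -> s = t.
Proof.
case: s t => [f fP] [g gP] /= /funext fg; case: _ / fg gP => gP.
by congr Series; apply: Prop_irrelevance.
Qed.

Fact normal_subproof (f : int -> \bar int) :
  {homo (fun k => zsup [set f j | j in [set j | j <= k]])
    : j k / j <= k >-> (j <= k)%E}.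
Proof.
move=> j k jk; apply/zsup_leP => _ [i /= ij <-]; apply: zsup_ub.
by exists i => //=; apply: le_trans jk.
Qed.

(** The class of an arbitrary formal series [\sum_k f k g^k]. *)
Definition normal (f : int -> \bar int) : series := Series (normal_subproof f).

(** [monomial t n] is [t g^n]. *)
Definition monomial (t n : int) : series :=
  normal (fun k => if k == n then t%:E else -oo%E).

Lemma monomialE t n k : monomial t n k = if n <= k then t%:E else -oo%E.
Proof.
apply: le_eqP => z; split=> [/zsup_leP H|H].
  by case: ifPn => [nk|]; [apply: H; exists n => //=; rewrite eqxx|rewrite leNye].
apply/zsup_leP => _ [j /= jk <-]; case: eqP => [jn|_]; last by rewrite leNye.
by move: H; rewrite -jn jk.
Qed.

Definition szero : series := @Series (fun _ => -oo%E) (fun _ _ _ => lexx _).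

Definition sone : series := monomial 0 0.

Fact sadd_subproof (s t : series) :
  {homo (fun k => Order.max (s k) (t k)) : j k / j <= k >-> (j <= k)%E}.
Proof.
by move=> j k jk; rewrite ge_max !le_max !coef_homo //= orbT.
Qed.

Definition sadd (s t : series) : series := Series (sadd_subproof s t).

Definition cauchy (s t : int -> \bar int) (k : int) : \bar int :=
  zsup [set (s ij.1 + t ij.2)%E | ij in [set ij : int * int | ij.1 + ij.2 = k]].

Lemma cauchyP s t k z :
  (cauchy s t k <= z)%E <-> (forall i j, i + j = k -> (s i + t j <= z)%E).
Proof.
split=> [/zsup_leP H i j ijk|H]; first by apply: H; exists (i, j).
by apply/zsup_leP => _ [[i j] /= ijk <-]; apply: H.
Qed.

Lemma cauchy_ub s t i j : (s i + t j <= cauchy s t (i + j)%R)%E.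
Proof. by have /cauchyP := lexx (cauchy s t (i + j)); apply. Qed.

Fact smul_subproof (s t : series) :
  {homo cauchy s t : j k / j <= k >-> (j <= k)%E}.
Proof.
move=> k k' kk'; apply/cauchyP => i j ijk.
apply: (@le_trans _ _ (s i + t (k' - i)%R)%E).
  by rewrite leeD2l ?coef_homo //; lia.
by have := cauchy_ub s t i (k' - i); rewrite subrKC.
Qed.

Definition smul (s t : series) : series := Series (smul_subproof s t).

Lemma sadd_normal f g :
  sadd (normal f) (normal g) = normal (fun k => Order.max (f k) (g k)).
Proof.
apply: seriesP => k; apply: le_eqP => z /=; rewrite ge_max; split.
  case/andP => /zsup_leP fz /zsup_leP gz; apply/zsup_leP => _ [j /= jk <-].
  by rewrite ge_max fz ?gz //; exists j.
move=> /zsup_leP H; apply/andP; split; apply/zsup_leP => _ [j /= jk <-].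
  by apply: (@le_trans _ _ (Order.max (f j) (g j)));
     [rewrite le_max lexx|apply: H; exists j].
by apply: (@le_trans _ _ (Order.max (f j) (g j)));
   [rewrite le_max lexx orbT|apply: H; exists j].
Qed.

Lemma smul_normal f g : smul (normal f) (normal g) = normal (cauchy f g).
Proof.
apply: seriesP => k; apply: le_eqP => z; split=> [/cauchyP H|/zsup_leP H].
  apply/zsup_leP => _ [m /= mk <-]; apply/cauchyP => i j ijm.
  apply: le_trans _ (H i (k - i) (subrKC _ _)).
  by apply: leeD; apply: zsup_ub; [exists i => /=|exists j => //=; lia].
apply/cauchyP => i j ijk; apply/zsup_addP => _ [i' /= i'i <-].
rewrite addeC; apply/zsup_addP => _ [j' /= j'j <-]; rewrite addeC.
apply: le_trans (cauchy_ub f g i' j') _.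
by apply: H; exists (i' + j') => //=; lia.
Qed.

Fact saddA : associative sadd.
Proof. by move=> s t u; apply: seriesP => k /=; rewrite maxA. Qed.

Fact saddC : commutative sadd.
Proof. by move=> s t; apply: seriesP => k /=; rewrite maxC. Qed.

Fact sadd0 : left_id szero sadd.
Proof. by move=> s; apply: seriesP => k /=; rewrite max_r ?leNye. Qed.

Fact smulC : commutative smul.
Proof.
move=> s t; apply: seriesP => k; apply: le_eqP => z.
by split=> /cauchyP H; apply/cauchyP => i j ijk; rewrite addeC; apply: H; lia.
Qed.

Fact smulA : associative smul.
Proof.
move=> s t u; apply: seriesP => k; apply: le_eqP => z; split=> /cauchyP H.
  apply/cauchyP => ij m ijmk; apply/zsup_addP => _ [[i j] /= ijE <-].
  rewrite -addeA; have := H i (j + m); rewrite addrA ijE => /(_ ijmk).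
  by apply: le_trans; rewrite leeD2l ?cauchy_ub.
apply/cauchyP => i jm ijmk; rewrite addeC.
apply/zsup_addP => _ [[j m] /= jmE <-]; rewrite addeC addeA.
have := H (i + j) m; rewrite -addrA jmE => /(_ ijmk).
by apply: le_trans; rewrite leeD2r ?cauchy_ub.
Qed.

Fact smul1 : left_id sone smul.
Proof.
move=> s; apply: seriesP => k; apply: le_eqP => z; split=> [/cauchyP H|H].
  by have := H 0 k (add0r k); rewrite monomialE lexx add0e.
apply/cauchyP => i j ijk; rewrite monomialE; case: ifPn => i0.
  by rewrite add0e; apply: le_trans H; apply: coef_homo; lia.
by rewrite addNye leNye.
Qed.

Fact smulDl : left_distributive smul sadd.
Proof.
move=> s t u; apply: seriesP => k; apply: le_eqP => z /=.
rewrite ge_max; split=> [/cauchyP H|].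
  apply/andP; split; apply/cauchyP => i j /H; apply: le_trans;
    by rewrite leeD2r //= le_max lexx ?orbT.
case/andP => /cauchyP Hs /cauchyP Ht; apply/cauchyP => i j ijk /=.
by case: (leP (s i) (t i)) => _; [apply: Ht|apply: Hs].
Qed.

Fact smul0 : left_zero szero smul.
Proof.
move=> s; apply: seriesP => k; apply/eqP; rewrite -leeNy_eq.
by apply/cauchyP => i j _; rewrite addNye.
Qed.

Fact sone_neq0 : sone != szero.
Proof. by apply/eqP => /(congr1 (fun s : series => s 0)); rewrite monomialE. Qed.

(** From here on [+], [*], [0], [1] on series (and, through [+], [*m], [1%:M] and
    [^+], on matrices of series) are the idempotent sum, the product, the zero
    and the unit of the semiring. *)
HB.instance Definition _ := GRing.isNmodule.Build series saddA saddC sadd0.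

Fact smul1r : right_id (sone : series) smul.
Proof. by move=> s; rewrite smulC smul1. Qed.
Fact smulDr : right_distributive smul sadd.
Proof. by move=> s t u; rewrite ![smul s _]smulC smulDl. Qed.
Fact smul0r : right_zero szero smul.
Proof. by move=> s; rewrite smulC smul0. Qed.

HB.instance Definition _ := GRing.Nmodule_isNzSemiRing.Build series
  smulA smul1 smul1r smulDl smulDr smul0 smul0r sone_neq0.
HB.instance Definition _ := GRing.PzSemiRing_hasCommutativeMul.Build series smulC.

Definition sle (a b : series) : bool := b == b + a.

Lemma sleP (a b : series) : reflect (forall k, (a k <= b k)%E) (sle a b).
Proof.
apply: (iffP eqP) => [-> k|ab]; first by rewrite /= le_max lexx orbT.
by apply: seriesP => k /=; rewrite max_l.
Qed.

Fact sle_refl : reflexive sle.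
Proof. by move=> a; apply/sleP. Qed.
Fact sle_anti : antisymmetric sle.
Proof.
move=> a b /andP[/sleP ab /sleP ba]; apply: seriesP => k.
by apply: le_anti; rewrite ab ba.
Qed.
Fact sle_trans : transitive sle.
Proof.
move=> b a c /sleP ab /sleP bc; apply/sleP => k; exact: le_trans (ab k) (bc k).
Qed.

Fact series_display : Order.disp_t. Proof. exact: Order.Disp tt tt. Qed.

HB.instance Definition _ := Order.Le_isPOrder.Build series_display series
  sle_refl sle_anti sle_trans.

Lemma les_coefP (a b : series) : reflect (forall k, (a k <= b k)%E) (a <= b)%O.
Proof. exact: sleP. Qed.

Fact smeet_subproof (s t : series) :
  {homo (fun k => Order.min (s k) (t k)) : j k / j <= k >-> (j <= k)%E}.
Proof.
by move=> j k jk; rewrite le_min !ge_min !coef_homo //= orbT.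
Qed.

Definition smeet (s t : series) : series := Series (smeet_subproof s t).

Fact smeetP (a b c : series) : (a <= smeet b c)%O = (a <= b)%O && (a <= c)%O.
Proof.
apply/les_coefP/andP => [H|[/les_coefP ab /les_coefP ac] k]; last first.
  by rewrite /= le_min ab ac.
by split; apply/les_coefP => k; have := H k; rewrite /= le_min => /andP[].
Qed.

Fact sjoinP (a b c : series) : (a + b <= c)%O = (a <= c)%O && (b <= c)%O.
Proof.
apply/les_coefP/andP => [H|[/les_coefP ac /les_coefP bc] k]; last first.
  by rewrite /= ge_max ac bc.
by split; apply/les_coefP => k; have := H k; rewrite /= ge_max => /andP[].
Qed.

HB.instance Definition _ :=
  Order.POrder_MeetJoin_isLattice.Build series_display series smeetP sjoinP.

Fact ssum_subproof (A : set series) :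
  {homo (fun k => zsup [set s k | s in A]) : j k / j <= k >-> (j <= k)%E}.
Proof.
move=> j k jk; apply/zsup_leP => _ [s As <-].
by apply: le_trans (coef_homo s jk) _; apply: zsup_ub; exists s.
Qed.

Definition ssum (A : set series) : series := Series (ssum_subproof A).

Lemma ssum_leP (A : set series) t : (ssum A <= t)%O <-> (forall s, A s -> s <= t)%O.
Proof.
split=> [/les_coefP H s As|H].
  by apply/les_coefP => k; apply: le_trans (H k); apply: zsup_ub; exists s.
by apply/les_coefP => k; apply/zsup_leP => _ [s /H/les_coefP st <-].
Qed.

Lemma ssum_mull (A : set series) t : ssum A * t = ssum [set s * t | s in A].
Proof.
apply: seriesP => k; apply: le_eqP => z; split=> [/cauchyP H|/zsup_leP H].
  apply/zsup_leP => _ [_ [s As <-] <-]; apply/cauchyP => i j /H /zsup_addP.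
  by apply; exists s.
apply/cauchyP => i j ijk; apply/zsup_addP => _ [s As <-].
apply: le_trans (cauchy_ub s t i j) _; rewrite ijk.
by apply: H; exists (s * t) => //; exists s.
Qed.

Definition lemx m n (M N : 'M[series]_(m, n)) : Prop :=
  forall i j, (M i j <= N i j)%O.

Definition meetmx m n (M N : 'M[series]_(m, n)) : 'M[series]_(m, n) :=
  map2_mx Order.meet M N.

Definition star (a : series) : series := ssum (range (fun k : nat => a ^+ k)).

Definition starmx n (M : 'M[series]_n) : 'M[series]_n :=
  \matrix_(i, j) ssum (range (fun k : nat => (M ^+ k) i j)).

(** [resmx P Q] is [P / Q]: the sum of all [X] with [X *m Q] below [P], which is
    itself such an [X] and hence the greatest one, see [resmxP]. *)
Definition resmx n m q (P : 'M[series]_(n, q)) (Q : 'M[series]_(m, q)) :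
    'M[series]_(n, m) :=
  \matrix_(i, j) ssum [set X i j | X in [set X | lemx (X *m Q) P]].

Definition least_solution n (f : 'cV[series]_n -> 'cV[series]_n)
    (x : 'cV[series]_n) : Prop :=
  x = f x /\ forall z, z = f z -> lemx x z.

Lemma les_mul (a b c d : series) : (a <= b -> c <= d -> a * c <= b * d)%O.
Proof.
move=> /les_coefP ab /les_coefP cd; apply/les_coefP => k; apply/cauchyP => i j ijk.
apply: (@le_trans _ _ (b i + d j)%E); first exact: leeD.
by rewrite -ijk cauchy_ub.
Qed.

Lemma sum_leP (I : finType) (F : I -> series) t :
  (\sum_i F i <= t)%O <-> (forall i, F i <= t)%O.
Proof.
split=> [H i|H].
  by apply: le_trans H; rewrite (bigD1 i) //= leUl.
elim/big_ind: _ => // [|a b at_ bt]; last by rewrite leUx at_ bt.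
by apply/les_coefP => k; rewrite leNye.
Qed.

Lemma lemx_mul m n q (M M' : 'M[series]_(m, n)) (N N' : 'M[series]_(n, q)) :
  lemx M M' -> lemx N N' -> lemx (M *m N) (M' *m N').
Proof.
move=> MM NN i j; rewrite !mxE; apply/sum_leP => h.
have /sum_leP /(_ h) := lexx (\sum_h M' i h * N' h j).
by apply: le_trans; apply: les_mul.
Qed.

Lemma lemx_trans m n (M N P : 'M[series]_(m, n)) :
  lemx M N -> lemx N P -> lemx M P.
Proof. by move=> MN NP i j; apply: le_trans (MN i j) (NP i j). Qed.

Lemma lemx_add m n (M N P : 'M[series]_(m, n)) :
  lemx (M + N) P <-> lemx M P /\ lemx N P.
Proof.
split=> [H|[MP NP] i j]; last by rewrite !mxE leUx MP NP.
by split=> i j; have := H i j; rewrite mxE leUx => /andP[].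
Qed.

Lemma resmxP n m q (X : 'M[series]_(n, m)) (P : 'M[series]_(n, q))
    (Q : 'M[series]_(m, q)) :
  lemx (X *m Q) P <-> lemx X (resmx P Q).
Proof.
split=> [XQ i j|XR].
  rewrite mxE; have /ssum_leP := lexx (ssum [set X i j | X in [set X | lemx (X *m Q) P]]).
  by apply; exists X.
apply: lemx_trans (lemx_mul XR (fun _ _ => lexx _)) _ => i j.
rewrite mxE; apply/sum_leP => h; rewrite mxE ssum_mull.
apply/ssum_leP => _ [_ [Y YQ <-] <-]; apply: le_trans (YQ i j).
by rewrite mxE; have /sum_leP := lexx (\sum_h Y i h * Q h j).
Qed.

Lemma starmx_mulP n q (M : 'M[series]_n) (b z : 'M[series]_(n, q)) :
  lemx (starmx M *m b) z <-> (forall k : nat, lemx (M ^+ k *m b) z).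
Proof.
split=> [H k|H i j].
  apply: lemx_trans H; apply: lemx_mul => // i j; rewrite mxE.
  by have /ssum_leP := lexx (ssum (range (fun k : nat => (M ^+ k) i j))); apply; exists k.
rewrite mxE; apply/sum_leP => h; rewrite mxE ssum_mull.
apply/ssum_leP => _ [_ [k _ <-] <-]; apply: le_trans (H k i j).
by rewrite mxE; have /sum_leP := lexx (\sum_h (M ^+ k) i h * b h j).
Qed.

Lemma starmx_least n (M : 'M[series]_n) (b : 'cV[series]_n) :
  least_solution (fun z => M *m z + b) (starmx M *m b).
Proof.
set x := starmx M *m b.
have post z : lemx (M *m z + b) z -> lemx x z.
  case/lemx_add => Mz bz; apply/starmx_mulP; elim=> [|k IH].
    by rewrite expr0 mul1mx.
  rewrite exprS -mulmxA; apply: lemx_trans Mz; exact: lemx_mul.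
have /starmx_mulP xk : lemx x x by [].
have xpost : lemx (M *m x + b) x.
  apply/lemx_add; split; last by have := xk 0%N; rewrite expr0 mul1mx.
  move=> i j; rewrite mxE; apply/sum_leP => h; rewrite mulrC.
  rewrite mxE mulr_suml; apply/sum_leP => h'; rewrite mxE ssum_mull ssum_mull.
  apply/ssum_leP => _ [_ [_ [k _ <-] <-] <-]; apply: le_trans (xk k.+1 i j).
  rewrite exprS -mulmxA mxE mulrC.
  apply: (@le_trans _ _ (M i h * (M ^+ k *m b) h j)).
    apply: les_mul => //; rewrite mxE.
    by have /sum_leP := lexx (\sum_h' (M ^+ k) h h' * b h' j).
  by have /sum_leP := lexx (\sum_h M i h * (M ^+ k *m b) h j).
split; last by move=> z zE; apply: post; rewrite -zE.
apply/matrixP => i j; apply: le_anti; rewrite xpost andbT.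
apply: post; apply/lemx_add; split=> //; last first.
  by move=> i' j'; rewrite [leRHS]mxE leUr.
apply: (@lemx_trans _ _ _ (M *m x)); first exact: lemx_mul.
by move=> i' j'; rewrite [leRHS]mxE leUl.
Qed.

(** There is an arc from [j] to [i] when [A i j != 0]: indices are transposed. *)
Definition arc n (A : 'M[series]_n) : rel 'I_n := fun j i => A i j != 0.

Definition scc n (A : 'M[series]_n) : {set {set 'I_n}} :=
  equivalence_partition
    (fun i j => connect (arc A) i j && connect (arc A) j i) [set: 'I_n].

Definition input_mx m n (M : 'M[series]_(m, n)) : Prop :=
  (forall j, exists2 i, M i j = 1 & forall i', i' != i -> M i' j = 0) /\
  (forall i j j', M i j = 1 -> M i j' = 1 -> j = j').

Definition polynomial (s : series) : Prop :=
  exists ms : seq (int * int), s = \sum_(m <- ms) monomial m.1 m.2.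

Definition periodic_form (s p q : series) (tau nu : nat) : Prop :=
  [/\ polynomial p, polynomial q & s = p + q * star (monomial tau nu)].

Definition periodic (s : series) : Prop :=
  exists p q tau nu, periodic_form s p q tau nu.

Lemma coefD (s t : series) k : (s + t) k = Order.max (s k) (t k).
Proof. by []. Qed.

Lemma monomial_mulE t n (s : series) k : (monomial t n * s) k = (t%:E + s (k - n)%R)%E.
Proof.
apply: le_eqP => z; split=> [/cauchyP H|H].
  by have := H n (k - n) (subrKC _ _); rewrite monomialE lexx.
apply/cauchyP => i j ijk; rewrite monomialE; case: ifPn => ni.
  by apply: le_trans H; rewrite leeD2l // coef_homo //; lia.
by rewrite addNye leNye.
Qed.

Lemma monomial_exp t n (i : nat) : monomial t n ^+ i = monomial (t * i%:Z) (n * i%:Z).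
Proof.
elim: i => [|i IH]; first by rewrite expr0 !mulr0.
apply: seriesP => k; rewrite exprS IH monomial_mulE !monomialE.
have -> : n * i.+1%:Z = n + n * i%:Z by lia.
have -> : t * i.+1%:Z = t + t * i%:Z by lia.
by rewrite lerBrDl; case: ifP.
Qed.

Lemma star_ge (a : series) i : (a ^+ i <= star a)%O.
Proof. by have /ssum_leP := lexx (star a); apply; exists i. Qed.

Lemma polynomialD p q : polynomial p -> polynomial q -> polynomial (p + q).
Proof. by move=> [a ->] [b ->]; exists (a ++ b); rewrite big_cat. Qed.

Lemma periodic_form_gt0 s p q tau nu :
  ~ polynomial s -> periodic_form s p q tau nu -> (0 < tau)%N.
Proof.
move=> sP [pP qP sE]; case: tau sE => // sE; exfalso; apply: sP.
rewrite sE; apply: polynomialD => //; suff -> : star (monomial 0%N nu) = 1 by rewrite mulr1.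
apply: le_anti; rewrite (star_ge _ 0) andbT; apply/ssum_leP => _ [i _ <-].
apply/les_coefP => k; rewrite monomial_exp mul0r !monomialE.
by case: ifPn => [ik|_]; [rewrite ifT //; lia|rewrite leNye].
Qed.

Lemma periodic_form_lower s p q tau nu :
  ~ polynomial s -> periodic_form s p q tau nu ->
  exists t n : int, 0 <= n /\
    forall i : nat, ((t + tau%:Z * i)%R%:E <= s (n + nu%:Z * i)%R)%E.
Proof.
move=> sP [pP [[|[t n] ms] qE] sE].
  by exfalso; apply: sP; rewrite sE qE big_nil mul0r addr0.
exists t, `|n|; split=> // i.
apply: (@le_trans _ _ (s (n + nu%:Z * i))); last by apply: coef_homo; lia.
rewrite sE qE big_cons mulrDl !coefD !le_max; apply/orP; right; apply/orP; left.
rewrite monomial_mulE /= EFinD leeD2l //.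
have /les_coefP/(_ (n + nu%:Z * i - n)) := star_ge (monomial tau nu) i.
by rewrite monomial_exp monomialE [n + _]addrC addrK lexx.
Qed.

Lemma periodic_form_upper s p q tau nu :
  periodic_form s p q tau nu ->
  exists c : int, forall k t : int, 0 <= k -> (t%:E <= s k)%E ->
    nu%:Z * t <= tau%:Z * k + c.
Proof.
move=> [pP qP sE]; case: (posnP nu) => [->|nu0].
  by exists 0 => k t k0 _; rewrite mul0r addr0 mulr_ge0.
set r := star _ in sE.
have [ms pqE] := polynomialD pP qP.
have : (s <= (\sum_(m <- ms) monomial m.1 m.2) * r)%O.
  rewrite -pqE mulrDl sE leUx leUr andbT; apply: le_trans (leUl _ _).
  by rewrite -{1}(mulr1 p) les_mul // (star_ge _ 0).
move=> {pqE sE pP qP}; elim: ms s => [|[t n] ms IH] s /les_coefP sP.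
  by exists 0 => k t _ /le_trans /(_ (sP k)); rewrite big_nil mul0r.
have [c cP] := IH _ (lexx _).
exists (`|c| + `|nu%:Z * t - tau%:Z * n|) => k u k0 /le_trans /(_ (sP k)).
rewrite big_cons mulrDl coefD le_max => /orP[]; last first.
  by move/cP => /(_ k0); lia.
rewrite monomial_mulE -[(t, n).1]/t -[(t, n).2]/n => ur.
suff : nu%:Z * (u - t) <= tau%:Z * (k - n) by rewrite !mulrBr; lia.
rewrite leNgt; apply/negP => lt.
have : (r (k - n)%R <= (u - t - 1)%R%:E)%E.
  apply/zsup_leP => _ [_ [i _ <-] <-]; rewrite monomial_exp monomialE.
  case: ifPn => [ik|_]; last by rewrite leNye.
  have : tau%:Z * (nu%:Z * i) <= tau%:Z * (k - n) by rewrite ler_wpM2l.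
  move=> /le_lt_trans /(_ lt); rewrite mulrCA ltr_pM2l // lee_fin; lia.
case: (r (k - n)) ur => [v| |] //.
by rewrite -EFinD !lee_fin; lia.
Qed.

Lemma periodic_form_le s p q tau nu p' q' tau' nu' :
  ~ polynomial s -> periodic_form s p q tau nu ->
  periodic_form s p' q' tau' nu' -> (nu' * tau <= tau' * nu)%N.
Proof.
move=> sP /(periodic_form_lower sP)[t [n [n0 low]]] /periodic_form_upper[c up].
have {}up (i : nat) : nu'%:Z * (t + tau%:Z * i) <= tau'%:Z * (n + nu%:Z * i) + c.
  by apply: up (low i); rewrite addr_ge0 ?mulr_ge0.
rewrite leqNgt; apply/negP => lt.
pose d : int := tau'%:Z * n + c - nu'%:Z * t; pose i : nat := `|d|.+1.
have di : d < i%:Z by rewrite /i; lia.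
have := up i; rewrite !mulrDr !mulrA.
have : i%:Z <= (nu'%:Z * tau%:Z - tau'%:Z * nu%:Z) * i%:Z.
  by rewrite ler_peMl // -!PoszM; lia.
rewrite mulrBl; move: di; rewrite /d; lia.
Qed.

(** The value is taken from any periodic form; it does not depend on the choice,
    see [slopeE], and [0 < tau] by [periodic_form_gt0]. *)
Definition slope (s : series) : \bar rat :=
  if `[< polynomial s >] then +oo%E
  else xget +oo%E
    [set r | exists p q tau nu,
       periodic_form s p q tau nu /\ r = (nu%:Q / tau%:Q)%:E].

Lemma slope_polynomial s : polynomial s -> slope s = +oo%E.
Proof. by move=> sP; rewrite /slope asboolT. Qed.

Lemma slopeE s p q tau nu :
  ~ polynomial s -> periodic_form s p q tau nu -> slope s = (nu%:Q / tau%:Q)%:E.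
Proof.
move=> sP sf; rewrite /slope asboolF //; case: xgetP => [r _|no].
  case=> [p' [q' [tau' [nu' [sf' ->]]]]]; congr (_%:E).
  have t0 := periodic_form_gt0 sP sf; have t0' := periodic_form_gt0 sP sf'.
  apply/eqP; rewrite eqr_div ?intr_eq0; try lia.
  rewrite -!intrM eqr_int; apply/eqP.
  by have := periodic_form_le sP sf sf'; have := periodic_form_le sP sf' sf; lia.
by case: (no (nu%:Q / tau%:Q)%:E); exists p, q, tau, nu.
Qed.

(* Main.v *)
(** Residuation gives [Lx *m C *m x <= x], hence [xhat <= x].  Conversely
    [C^T *m C <= 1] makes [C^T] admissible in both residuals, so [C^T <= Lx] and
    [xhat] dominates [x] at every measured transition.  A strongly connected
    component contains a measured transition, reachable from and reaching any
    other one [i] through nonzero entries of powers of [A]; going round and using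
    [A *m x <= x], [A *m xhat <= xhat] yields [g * x i <= xhat i <= x i] for some
    [g != 0].  Multiplication by [g] only costs a shift in [gamma] and an additive
    constant, which does not change the asymptotic slope. *)

Require Import Defs.
From HB Require Import structures.
From mathcomp Require Import all_boot all_order all_algebra.
From mathcomp Require Import boolp classical_sets constructive_ereal.
From mathcomp Require Import zify.
Import Order.TTheory GRing.Theory Num.Theory.
Local Open Scope ring_scope.

Lemma les0 (s : series) : ((0 : series) <= s)%O.
Proof. by apply/les_coefP => k; rewrite leNye. Qed.

Lemma les_term (I : finType) (F : I -> series) i : (F i <= \sum_j F j)%O.
Proof. by have /sum_leP := lexx (\sum_j F j). Qed.

(** Serves to extract a monomial below a nonzero series; a coefficient [+oo] qualifies too, being
    above every integer. *)
Lemma series_neq0P (s : series) :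
  s != 0 <-> exists k t : int, (t%:E <= s k)%E.
Proof.
split=> [|[k [t tk]]]; last first.
  by apply/eqP => s0; move: tk; rewrite s0.
move=> s0; apply: contrapT => H; move/eqP: s0; apply; apply: seriesP => k /=.
case sk: (s k) => [t| |] //; exfalso; apply: H.
  by exists k, t; rewrite sk.
by exists k, 0; rewrite sk.
Qed.

(** Integer lower bounds on two coefficients add up to one on a coefficient of the Cauchy
    product. *)
Lemma mulS_neq0 (s t : series) : s != 0 -> t != 0 -> s * t != 0.
Proof.
move=> /series_neq0P[i [a ai]] /series_neq0P[j [b bj]].
apply/series_neq0P; exists (i + j), (a + b).
by apply: le_trans (cauchy_ub s t i j); rewrite EFinD leeD.
Qed.

Lemma polynomial_ub {s} :
  Defs.polynomial s -> exists c : int, forall k, (s k <= c%:E)%E.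
Proof.
move=> [ms ->]; elim: ms => [|[t n] ms [c IH]].
  by exists 0 => k; rewrite big_nil leNye.
exists (Num.max t c) => k; rewrite big_cons Defs.coefD ge_max; apply/andP; split.
  by rewrite monomialE; case: ifP; rewrite ?leNye // lee_fin le_max lexx.
by apply: le_trans (IH k) _; rewrite lee_fin le_max lexx orbT.
Qed.

(** Up to a translation, [s] dominates points going to infinity in the direction [(nut, taut)]; the
    linear upper bound on [s] then forces [nus * taut <= taus * nut]. *)
Lemma slope_le (s t : series) (d c : int) :
  periodic s -> periodic t ->
  (forall k, (c%:E + t (k - d)%R <= s k)%E) -> (slope s <= slope t)%E.
Proof.
move=> [ps [qs [taus [nus sf]]]] [pt [qt [taut [nut tf]]]] ts.
have [tP|tP] := pselect (Defs.polynomial t); first by rewrite (slope_polynomial tP) leey.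
have taut0 := periodic_form_gt0 tP tf.
have [T [N [N0 low]]] := periodic_form_lower tP tf.
(* Shifting by [|d|] instead of [d] keeps the index nonnegative, as [periodic_form_upper] requires;
   monotonicity of [t] absorbs the excess. *)
have {}low (i : nat) : ((c + T + taut%:Z * i)%:E <= s (N + `|d|%N + nut%:Z * i)%R)%E.
  apply: le_trans (ts _); rewrite -addrA EFinD leeD2l //.
  by apply: le_trans (low i) _; apply: coef_homo; lia.
have [sP|sP] := pselect (Defs.polynomial s).
  have [m sm] := polynomial_ub sP; exfalso.
  (* A polynomial is bounded by some [m], but [low] exceeds [m] once [i] exceeds [D], as [taut] is
     at least 1. *)
  pose D : int := m - c - T.
  have := le_trans (low `|D|%N.+1) (sm _); rewrite lee_fin.
  have : `|D|%N.+1%:Z <= taut%:Z * `|D|%N.+1%:Z by rewrite ler_peMl.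
  rewrite /D.
  lia.
have taus0 := periodic_form_gt0 sP sf.
rewrite (slopeE sP sf) (slopeE tP tf) lee_fin.
rewrite ler_pdivrMr ?ltr0z // mulrAC ler_pdivlMr ?ltr0z //.
rewrite -!intrM ler_int.
have [e up] := periodic_form_upper sf.
have {}up (i : nat) : nus%:Z * (c + T + taut%:Z * i) <=
    taus%:Z * (N + `|d|%N + nut%:Z * i) + e.
  by apply: up (low i); rewrite !addr_ge0 ?mulr_ge0.
rewrite leNgt; apply/negP => lt.
(* [D] gathers the constants of [up]: were the coefficient of [i] at least 1, [up] would give
   [i <= D], false at [|D| + 1]. *)
pose D : int := taus%:Z * (N + `|d|%N) + e - nus%:Z * (c + T).
have := up `|D|%N.+1; rewrite !mulrDr !mulrA.
have : `|D|%N.+1%:Z <= (nus%:Z * taut%:Z - taus%:Z * nut%:Z) * `|D|%N.+1%:Z.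
  by rewrite ler_peMl //; lia.
have : D < `|D|%N.+1%:Z by lia.
rewrite mulrBl /D; lia.
Qed.

Lemma slope_mul_le (g s t : series) :
  g != 0 -> periodic s -> periodic t -> (g * t <= s)%O ->
  (slope s <= slope t)%E.
Proof.
move=> /series_neq0P[d [c gd]] sP tP /les_coefP gts.
apply: (slope_le _ _ d c) => // k; apply: le_trans (gts k).
have := cauchy_ub g t d (k - d); rewrite subrKC; apply: le_trans.
exact: leeD2r.
Qed.

Lemma exprmx_prefixed n (M : 'M[series]_n) q (z : 'M[series]_(n, q)) m :
  lemx (M *m z) z -> lemx (M ^+ m *m z) z.
Proof.
move=> Mz; elim: m => [|m IH]; first by rewrite expr0 mul1mx.
by rewrite exprS -mulmxA; apply: lemx_trans Mz; apply: lemx_mul.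
Qed.

Lemma starmx_prefixed n (M : 'M[series]_n) (b z : 'cV[series]_n) :
  lemx (M *m z) z -> lemx b z -> lemx (starmx M *m b) z.
Proof.
move=> Mz bz; apply/starmx_mulP => m.
apply: lemx_trans (exprmx_prefixed _ _ _ z m Mz); exact: lemx_mul.
Qed.

Lemma starmx_mul_prefixed n (M : 'M[series]_n) (b : 'cV[series]_n) :
  lemx (M *m (starmx M *m b)) (starmx M *m b).
Proof.
have [e _] := starmx_least M b => i j; rewrite {2}e.
by rewrite [leRHS]mxE leUl.
Qed.

(** Induction on the path: the product of its nonzero arc weights is nonzero and lies below the
    entry. *)
Lemma connect_exprmx n (A : 'M[series]_n) i j :
  connect (Defs.arc A) i j -> exists m, (A ^+ m) j i != 0.
Proof.
case/connectP => s; elim: s i => [|h s IH] i /=.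
  by move=> _ ->; exists 0%N; rewrite expr0 mxE eqxx oner_neq0.
case/andP => ih hs js; have [m mP] := IH h hs js.
exists m.+1; apply/negP => /eqP E; have := mulS_neq0 _ _ mP ih.
rewrite exprSr -[_ * A]/(_ *m A) mxE in E.
by rewrite eq_le les0 andbT -E (les_term _ (fun l => (A ^+ m) j l * A l i)).
Qed.

Lemma exprmx_entry_le n (A : 'M[series]_n) (z : 'cV[series]_n) m i j :
  lemx (A *m z) z -> ((A ^+ m) i j * z j ord0 <= z i ord0)%O.
Proof.
move=> /(exprmx_prefixed _ _ _ _ m) /(_ i ord0); apply: le_trans.
by rewrite mxE (les_term _ (fun l => (A ^+ m) i l * z l ord0)).
Qed.

Lemma scc_pblockP n (A : 'M[series]_n) i :
  finset.pblock (scc A) i \in scc A /\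
  forall j, j \in finset.pblock (scc A) i -> connect (Defs.arc A) i j /\ connect (Defs.arc A) j i.
Proof.
have eqr : {in [set: 'I_n] & &, equivalence_rel
    (fun a b => connect (Defs.arc A) a b && connect (Defs.arc A) b a)}.
  move=> a b c _ _ _; split=> [|/andP[ab ba]]; first by rewrite connect0.
  apply/andP/andP => -[h1 h2]; split;
    by [exact: connect_trans h1 | exact: connect_trans h2 _
       |exact: connect_trans ab h1 | exact: connect_trans h2 ba
       |exact: connect_trans ba h1 | exact: connect_trans h2 ab].
have /and3P[/eqP cov _ _] := equivalence_partitionP eqr.
split; first by apply: finset.pblock_mem; rewrite cov inE.
by move=> j; rewrite (finset.pblock_equivalence_partition eqr) ?inE // => /andP[].
Qed.

(** Row [j] of [C] vanishes outside one column [h], so it only contributes to the diagonal entry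
    [(h, h)]. *)
Lemma trmx_mul_le1 n k (C : 'M[series]_(k, n)) :
  input_mx C^T -> lemx (C^T *m C) 1%:M.
Proof.
case=> H _ i i'; rewrite mxE; apply/sum_leP => j.
have [h h1 h0] := H j; rewrite mxE in h1.
have C0 a : a != h -> C j a = 0 by move=> /h0; rewrite mxE.
have [->|/C0 E] := eqVneq i h; last by rewrite mxE E mul0r les0.
have [->|/C0 E] := eqVneq i' h; last by rewrite E mulr0 les0.
by rewrite !mxE h1 mulr1 eqxx.
Qed.

Lemma lemx_residual n m q (C : 'M[series]_(m, n)) (P : 'M[series]_(n, q)) :
  lemx (C^T *m C) 1%:M -> lemx C^T (resmx P (C *m P)).
Proof.
move=> CC; apply/resmxP; rewrite mulmxA.
by rewrite -{2}(mul1mx P); apply: lemx_mul.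
Qed.

Lemma lemx_meet m n (X M N : 'M[series]_(m, n)) :
  lemx X (meetmx M N) <-> lemx X M /\ lemx X N.
Proof.
split=> [H|[XM XN] i j]; last by rewrite mxE lexI XM XN.
by split=> i j; have := H i j; rewrite mxE lexI => /andP[].
Qed.

Theorem proposition3 (n p l k : nat)
    (A : 'M[series]_n) (B : 'M[series]_(n, p)) (R : 'M[series]_(n, l))
    (C : 'M[series]_(k, n))
    (hB : input_mx B) (hR : input_mx R) (hC : input_mx C^T)
    (hA : forall i j, periodic (starmx A i j))
    (hk : k = #|scc A|)
    (hout : forall K : {set 'I_n}, K \in scc A ->
       exists! j : 'I_k, exists2 i, i \in K & C j i = 1)
    (u : 'cV[series]_p) (w : 'cV[series]_l) :
  let Lx := meetmx (resmx (starmx A *m B) (C *m starmx A *m B))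
                   (resmx (starmx A *m R) (C *m starmx A *m R)) in
  let x := starmx A *m B *m u + starmx A *m R *m w in
  let y := C *m x in
  forall xhat : 'cV[series]_n,
    least_solution (fun z => A *m z + B *m u + Lx *m (C *m z + y)) xhat ->
  forall i : 'I_n,
    periodic (x i ord0) -> periodic (xhat i ord0) ->
    slope (x i ord0) = slope (xhat i ord0).
Proof.
move=> Lx x y xhat [xhatE xhatmin] i xP xhatP.
have xE : x = starmx A *m (B *m u + R *m w) by rewrite /x mulmxDr !mulmxA.
have Ax : lemx (A *m x) x by rewrite xE; apply: starmx_mul_prefixed.
have Bx : lemx (B *m u) x.
  have [e _] := starmx_least A (B *m u + R *m w).
  move=> a b; rewrite xE e [leRHS]mxE; apply: le_trans (leUr _ _).
  by rewrite [leRHS]mxE leUl.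
have /lemx_meet[/resmxP LB /resmxP LR] : lemx Lx Lx by [].
have Lyx : lemx (Lx *m y) x.
  rewrite /y /x !mulmxDr !mulmxA; apply/lemx_add; split.
    apply: (@lemx_trans _ _ _ (starmx A *m B *m u)).
      by rewrite !mulmxA in LB *; apply: lemx_mul.
    by move=> a b; rewrite [leRHS]mxE leUl.
  apply: (@lemx_trans _ _ _ (starmx A *m R *m w)).
    by rewrite !mulmxA in LR *; apply: lemx_mul.
  by move=> a b; rewrite [leRHS]mxE leUr.
have xhat_le : lemx xhat x.
  (* In the form [z = M *m z + b], the observer equation has the fixed point [starmx M *m b], above
     [xhat] by minimality and below the prefixed point [x]. *)
  set M := A + Lx *m C; set b := B *m u + Lx *m y.
  have fE z : A *m z + B *m u + Lx *m (C *m z + y) = M *m z + b.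
    by rewrite /M /b mulmxDl mulmxDr mulmxA addrACA.
  have [solE _] := starmx_least M b.
  apply: (@lemx_trans _ _ _ (starmx M *m b)); first by apply: xhatmin; rewrite fE.
  apply: starmx_prefixed; last exact/lemx_add.
  by rewrite /M mulmxDl -mulmxA; apply/lemx_add.
have /lemx_add[/lemx_add[Axhat _] Lxhat] :
    lemx (A *m xhat + B *m u + Lx *m (C *m xhat + y)) xhat by rewrite -xhatE.
have CC := trmx_mul_le1 _ _ _ hC.
have CL : lemx C^T Lx.
  by apply/lemx_meet; rewrite -!mulmxA; split; apply: lemx_residual.
have measured j h : C j h = 1 -> (x h ord0 <= xhat h ord0)%O.
  move=> Cjh; apply: le_trans (Lxhat h ord0).
  apply: (@le_trans _ _ ((C^T *m y) h ord0)); last first.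
    by apply: lemx_mul => // a b; rewrite [leRHS]mxE leUr.
  rewrite [leRHS]mxE; apply: le_trans (les_term _ (fun i => C^T h i * y i ord0) j).
  rewrite [C^T h j]mxE Cjh mul1r [leRHS]mxE.
  by apply: le_trans (les_term _ (fun i => C j i * x i ord0) h); rewrite Cjh mul1r.
have [Ki KiP] := scc_pblockP _ A i.
have [j [[h /KiP[ih hi] Cjh] _]] := hout _ Ki.
have [a a0] := connect_exprmx _ _ _ _ ih.
have [b b0] := connect_exprmx _ _ _ _ hi.
apply/le_anti/andP; split.
  (* The larger series has the smaller slope. *)
  apply: (slope_mul_le 1); rewrite ?oner_neq0 // mul1r; exact: xhat_le.
(* Here [g] is [(A ^+ b) i h * (A ^+ a) h i]: from [i] to the measured [h], where [x] passes to
   [xhat], and back. *)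
apply: slope_mul_le (mulS_neq0 _ _ b0 a0) xhatP xP _.
apply: le_trans (exprmx_entry_le _ _ _ b i h Axhat); rewrite -mulrA.
apply: les_mul => //; apply: le_trans (measured _ _ Cjh).
exact: exprmx_entry_le.
Qed.
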